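(* Let $a,b>0$ and $c>a+b$ be real, and for $0<x,y<1$ let $$D_F(x,y)=F(a,b;c;x)+F(a,b;c;y)-F(a,b;c;x+y-xy).$$ Then for all $0<x,y<1$, $$|D_F(x,y)|\le A,\qquad A=A(a,b,c)=\frac{\Gamma(c)\Gamma(c-a-b)}{\Gamma(c-a)\Gamma(c-b)}=F(a,b;c;1),$$ and the constant $A$ is best possible, i.e. for the given $a,b,c$ no constant smaller than $A$ bounds $|D_F(x,y)|$ for all $0<x,y<1$.
   Context: $F(a,b;c;x)=\sum_{n=0}^{\infty}\frac{(a,n)(b,n)}{(c,n)}\frac{x^n}{n!}$ for $|x|<1$ is the Gaussian hypergeometric function, where $(a,0)=1$ and $(a,n)=a(a+1)\cdots(a+n-1)$ for $n\ge 1$. For $c>a+b$ the series also converges at $x=1$, and $F(a,b;c;1)$ denotes its value there. $\Gamma$ is the Euler gamma function. *)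

(* Defs.v *)
From HB Require Import structures.
From mathcomp Require Import all_boot all_order all_algebra.
From mathcomp Require Import all_classical all_reals all_analysis.

Set Implicit Arguments.
Unset Strict Implicit.
Unset Printing Implicit Defensive.

Import Order.TTheory GRing.Theory Num.Theory.
Import numFieldNormedType.Exports.

Local Open Scope classical_set_scope.
Local Open Scope ring_scope.

(* The rising factorial (a, n) = a (a + 1) ... (a + n - 1). *)
Definition rising (R : realType) (a : R) (n : nat) : R :=
  \prod_(i < n) (a + i%:R).

Definition hyp2F1_coef (R : realType) (a b c : R) (n : nat) : R :=
  rising a n * rising b n / rising c n / n`!%:R.

(* F(a, b; c; x); [limn] is total, so this is the sum of the series only where
   the series converges. *)
Definition hyp2F1 (R : realType) (a b c x : R) : R :=
  limn (pseries (hyp2F1_coef a b c) x).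

(* Euler's integral; it represents the gamma function for s > 0 only. *)
Definition Gamma (R : realType) (s : R) : R :=
  \int[@lebesgue_measure R]_(t in `]0, +oo[) (t `^ (s - 1) * expR (- t)).

Definition D_F (R : realType) (a b c x y : R) : R :=
  hyp2F1 a b c x + hyp2F1 a b c y - hyp2F1 a b c (x + y - x * y).

(* Main.v *)
Require Import Defs.
From HB Require Import structures.
From mathcomp Require Import all_boot all_order all_algebra.
From mathcomp Require Import all_classical all_reals all_analysis.
From mathcomp Require Import measurable_realfun.
From mathcomp Require Import ring lra.

Set Implicit Arguments.
Unset Strict Implicit.
Unset Printing Implicit Defensive.

Import Order.TTheory GRing.Theory Num.Theory.
Import numFieldNormedType.Exports.

Local Open Scope classical_set_scope.
Local Open Scope ring_scope.

(** The coefficients of [F] are positive, so [F] increases on [[0, 1]]; as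
    [x + y - x y] lies between [max x y] and [1], both [D_F] and [- D_F] are
    at most [F(a, b; c; 1)]. Letting [x = y] tend to [1], [D_F] tends to
    [2 F(a, b; c; 1) - F(a, b; c; 1)], which gives sharpness. The closed form
    is Gauss's summation theorem: [F(a, b; c; 1)] and the Gamma quotient both
    satisfy [c (c - a - b) g(c) = (c - a) (c - b) g(c + 1)], and both tend to
    [1] along [c + k], the latter by log-convexity of Gamma. *)

(** * Euler's integral: functional equation, finiteness, positivity and log-convexity *)

Section GammaFunction.
Variable R : realType.
Implicit Types s t u v x y : R.

Local Notation mu := (@lebesgue_measure R).

Definition gamma_integrand s t : R := t `^ (s - 1) * expR (- t).

(** Extended-real values let monotone limits and comparisons of integrals be used before finiteness
    is known; [eGamma_fin_num] settles it afterwards. *)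
Definition eGamma s : \bar R :=
  (\int[mu]_(t in `]0%R, +oo[) (gamma_integrand s t)%:E)%E.

Lemma fine_eGamma s : Gamma s = fine (eGamma s). Proof. by []. Qed.

Lemma gamma_integrand_ge0 s t : 0 <= gamma_integrand s t.
Proof. by rewrite mulr_ge0 ?powR_ge0 ?expR_ge0. Qed.

Lemma gamma_integrandE s t : 0 < t ->
  gamma_integrand s t = expR ((s - 1) * ln t - t).
Proof. by move=> t0; rewrite /gamma_integrand /powR gt_eqF// -expRD. Qed.

Lemma measurable_gamma_integrand (D : set R) s :
  measurable_fun D (gamma_integrand s).
Proof.
apply: measurable_funTS; apply: measurable_funM; first exact: measurable_powR.
by apply: measurableT_comp => //; exact: measurable_expR.
Qed.

Lemma continuous_powR s t : 0 < t -> {for t, continuous (@powR R ^~ s)}.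
Proof.
move=> t0; apply: differentiable_continuous; apply/derivable1_diffP.
by apply: derivable_powR; rewrite in_itv/= t0.
Qed.

Lemma continuous_expRN : continuous (fun t : R => expR (- t)).
Proof.
by move=> t; apply: continuous_comp;
  [exact: opp_continuous|exact: continuous_expR].
Qed.

Lemma is_derive_NexpRN t :
  is_derive t 1 (fun z : R => - expR (- z)) (expR (- t)).
Proof.
have h : is_derive t 1 (expR \o -%R) (expR (- t) * -1).
  exact: is_derive1_comp.
by have := is_deriveN h; rewrite mulrN1 opprK.
Qed.

Lemma derivable_cc_oo_LRcontinuous (f : R -> R) u v :
  u <= v -> (forall t, u <= t <= v -> derivable f t 1) ->
  derivable_oo_LRcontinuous f u v.
Proof.
move=> uv df; have cf t : u <= t <= v -> {for t, continuous f}.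
  by move=> /df /derivable1_diffP/differentiable_continuous.
split; first by move=> t /[!in_itv]/= /andP[/ltW ut /ltW tv]; apply/df/andP.
  by apply/cvg_at_right_filter/cf; rewrite lexx.
by apply/cvg_at_left_filter/cf; rewrite lexx andbT.
Qed.

(** Integration by parts, with [- expR (- t)] as primitive, on a compact interval away from the
    possible singularity at 0; the boundary terms are left for the limit. *)
Lemma integral_gamma_integrandS s u v : 0 < s -> 0 < u -> u < v ->
  (\int[mu]_(t in `[u, v]) (gamma_integrand (s + 1) t)%:E =
   (u `^ s * expR (- u) - v `^ s * expR (- v))%:E +
   s%:E * \int[mu]_(t in `[u, v]) (gamma_integrand s t)%:E)%E.
Proof.
move=> s0 u0 uv; have v0 := lt_trans u0 uv.
have in0 t : u <= t -> 0 < t by exact: lt_le_trans.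
under eq_integral do rewrite /gamma_integrand addrK.
rewrite (@integration_by_parts _ (@powR R ^~ s) (fun t => - expR (- t))
  (fun t => s * t `^ (s - 1)) (fun t => expR (- t)))//.
- rewrite -ge0_integralZl_EFin//=; last 3 first.
  + by move=> t _; rewrite lee_fin gamma_integrand_ge0.
  + by apply/measurable_EFinP; exact: measurable_gamma_integrand.
  + exact: ltW.
  congr (_ + _)%E; first by rewrite !mulrN opprK addrC.
  under eq_integral => t _ do rewrite mulrN EFinN -mulrA EFinM.
  rewrite integral_ge0N ?oppeK// => t _.
  by rewrite mule_ge0 ?lee_fin ?gamma_integrand_ge0// ltW.
- apply: continuous_in_subspaceT => t /[!inE]/= /[!in_itv]/= /andP[/in0 t0 _].
  by apply: cvgMl_tmp; exact: continuous_powR.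
- apply: derivable_cc_oo_LRcontinuous (ltW uv) _ => t /andP[/in0 t0 _].
  by apply: derivable_powR; rewrite in_itv/= t0.
- move=> t /[!in_itv]/= /andP[/ltW/in0 t0 _].
  by apply: powR_derive1; rewrite in_itv/= t0.
- by apply: continuous_subspaceT; exact: continuous_expRN.
- apply: derivable_cc_oo_LRcontinuous (ltW uv) _ => t _.
  exact/(@ex_derive _ _ _ _ _ _ _ (is_derive_NexpRN t)).
- move=> t _; rewrite derive1E.
  exact: (@derive_val _ _ _ _ _ _ _ (is_derive_NexpRN t)).
Qed.

(** These compact intervals exhaust the half-line. The upper end [n.+2%:R] keeps them nondegenerate
    already at [n = 0], as integration by parts requires. *)
Lemma bigcup_itv_harmonic :
  \bigcup_n `[(n.+1%:R^-1 : R), n.+2%:R]%classic = `]0%R, +oo[%classic.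
Proof.
apply/seteqP; split=> t /=.
  by move=> [n _] /=; rewrite !in_itv/= andbT => /andP[+ _]; apply: lt_le_trans;
    rewrite invr_gt0.
rewrite in_itv/= andbT => t0.
exists (maxn (Num.truncn t) (Num.truncn t^-1)) => //=; rewrite in_itv/=; apply/andP; split.
  rewrite invf_ple ?posrE//; apply: (le_trans (ltW (truncnS_gt _))).
  by rewrite ler_nat ltnS leq_maxr.
apply: (le_trans (ltW (truncnS_gt _))).
by rewrite ler_nat ltnS ltnW// ltnS leq_maxl.
Qed.

Lemma nondecreasing_itv_harmonic :
  nondecreasing_seq (fun n => `[(n.+1%:R^-1 : R), n.+2%:R]%classic).
Proof.
move=> m n mn; rewrite subsetEset => t /=; rewrite !in_itv/= => /andP[mt tm].
apply/andP; split; [apply: le_trans mt|apply: (le_trans tm)].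
  by rewrite lef_pV2 ?posrE// ler_nat ltnS.
by rewrite ler_nat !ltnS.
Qed.

Lemma cvg_eGamma s :
  (\int[mu]_(t in `[n.+1%:R^-1%R, n.+2%:R%R]) (gamma_integrand s t)%:E)%E
    @[n --> \oo] --> eGamma s.
Proof.
rewrite /eGamma -bigcup_itv_harmonic.
apply: (@ge0_nondecreasing_set_cvg_integral _ _ R).
- exact: nondecreasing_itv_harmonic.
- by move=> n; exact: measurable_itv.
- by move=> n; apply/measurable_EFinP; exact: measurable_gamma_integrand.
- by move=> n t _; rewrite lee_fin gamma_integrand_ge0.
Qed.

Lemma cvg_powR_expRN_at0 s : 0 < s ->
  n.+1%:R^-1 `^ s * expR (- n.+1%:R^-1) @[n --> \oo] --> (0 : R).
Proof.
move=> s0; rewrite -[X in _ --> X](mul0r (expR (- 0))); apply: cvgM.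
  have /cvg_at_rightP := powR_cvg0 s0; apply.
  by split; [move=> n; rewrite invr_gt0|exact: cvg_harmonic].
have := @continuous_expRN 0; apply: cvg_comp; exact: cvg_harmonic.
Qed.

Lemma powR_expRN_le s : 0 < s -> {C : R | forall t, 0 < t ->
  t `^ s * expR (- t) <= C / t}.
Proof.
move=> s0; pose r := s + 1; have r0 : 0 < r by rewrite addr_gt0.
exists (expR (r * (ln r - 1))) => t t0.
rewrite ler_pdivlMr// mulrAC -{2}(lnK t0) /powR gt_eqF// -!expRD ler_expR.
have tr0 : 0 < t / r by rewrite divr_gt0.
have : ln (t / r) <= t / r - 1.
  by have := @le_ln1Dx R (t / r - 1); rewrite subrKC; apply; lra.
rewrite ln_div// -(ler_pM2l r0) !mulrBr mulrCA divff ?gt_eqF// /r; nra.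
Qed.

Lemma cvg_powR_expRN s : 0 < s ->
  n.+2%:R `^ s * expR (- n.+2%:R) @[n --> \oo] --> (0 : R).
Proof.
move=> s0; have [C hC] := powR_expRN_le s0.
apply: (@squeeze_cvgr _ _ _ _ (cst 0) (fun n => C * harmonic n)); first last.
- by rewrite -[X in _ --> X](mulr0 C); apply: cvgMl_tmp; exact: cvg_harmonic.
- exact: cvg_cst.
apply: nearW => n; rewrite mulr_ge0 ?powR_ge0 ?expR_ge0//=.
apply: (le_trans (hC _ _)) => //; rewrite ler_wpM2l//.
  have := hC 1 ltr01; rewrite divr1 powR1 mul1r; apply: le_trans.
  exact: expR_ge0.
by rewrite lef_pV2 ?posrE// ler_nat.
Qed.

(** Limit of the integration by parts along the exhausting intervals, where both boundary terms
    vanish. *)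
Lemma eGammaS s : 0 < s -> eGamma (s + 1) = (s%:E * eGamma s)%E.
Proof.
move=> s0; have := @cvg_eGamma (s + 1).
have uv n : (n.+1%:R^-1 : R) < n.+2%:R.
  apply: (@le_lt_trans _ _ 1); last by rewrite ltr1n.
  by rewrite invf_le1// ler1n.
under eq_fun => n do rewrite integral_gamma_integrandS ?invr_gt0 //.
move=> cvgL; rewrite -[RHS]add0e; apply: cvg_unique cvgL _ => //.
apply: cvgeD.
- by rewrite fin_num_adde_defr.
- apply: cvg_EFin; first exact: nearW.
  rewrite -(subr0 0); apply: cvgB.
    exact: cvg_powR_expRN_at0.
  exact: cvg_powR_expRN.
- by apply: cvgeZl => //; exact: cvg_eGamma.
Qed.

Lemma eGamma1 : eGamma 1 = 1%E.
Proof.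
rewrite /eGamma /gamma_integrand subrr.
under eq_integral do rewrite powRr0 mul1r.
rewrite integral_itv_obnd_cbnd; last first.
  apply/measurable_EFinP; apply: measurable_funTS.
  by apply: continuous_measurable_fun; exact: continuous_expRN.
rewrite (@ge0_continuous_FTC2y _ (fun t => expR (- t))
  (fun t => - expR (- t)) 0 0)//.
- by rewrite oppr0 expR0 EFinN oppeK add0e.
- by apply: continuous_subspaceT; exact: continuous_expRN.
- by rewrite -oppr0; apply: cvgN; exact: cvgr_expR.
- by apply/cvg_at_right_filter; apply: cvgN; exact: (@continuous_expRN 0).
- by move=> t _; rewrite derive1E;
    exact: (@derive_val _ _ _ _ _ _ _ (is_derive_NexpRN t)).
Qed.

Lemma eGamma_ge0 s : (0 <= eGamma s)%E.
Proof.
by apply: integral_ge0 => t _; rewrite lee_fin gamma_integrand_ge0.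
Qed.

(** Weighted arithmetic-geometric mean inequality with a free balancing parameter [d]. Integrating
    it and then choosing [d] does the work of Hoelder's inequality. *)
Lemma gamma_integrand_le_convex x y l d t : 0 <= l <= 1 -> 0 < t ->
  gamma_integrand (l * x + (1 - l) * y) t <=
  l * expR (- ((1 - l) * d)) * gamma_integrand x t +
  (1 - l) * expR (l * d) * gamma_integrand y t.
Proof.
move=> /andP[l0 l1] t0; rewrite !gamma_integrandE// -!mulrA -!expRD.
(* The two exponents on the right are [w + (1 - l) * k] and [w - l * k]; with weights [l] and
   [1 - l] the terms in [k] cancel. *)
set w := (l * x + _ - 1) * ln t - t; pose k := (x - y) * ln t - d.
have -> : - ((1 - l) * d) + ((x - 1) * ln t - t) = w + (1 - l) * k.
  by rewrite /w /k; ring.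
have -> : l * d + ((y - 1) * ln t - t) = w - l * k by rewrite /w /k; ring.
(* the tangent of [expR] at [w] lies below its graph *)
have tangent z : expR w * (1 + z) <= expR (w + z).
  by rewrite (expRD w z) ler_wpM2l ?expR_ge0 ?expR_ge1Dx.
apply: (@le_trans _ _ (l * (expR w * (1 + (1 - l) * k)) +
                       (1 - l) * (expR w * (1 - l * k)))).
  by rewrite le_eqVlt; apply/orP; left; apply/eqP; ring.
by rewrite lerD// ler_wpM2l// subr_ge0.
Qed.

Lemma eGamma_le_convex x y l d : 0 <= l <= 1 ->
  (eGamma (l * x + (1 - l) * y)%R <=
   (l * expR (- ((1 - l) * d)))%:E * eGamma x +
   ((1 - l) * expR (l * d))%:E * eGamma y)%E.
Proof.
move=> l01; have /andP[l0 l1] := l01.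
have mI (D : set R) s : measurable_fun D (EFin \o gamma_integrand s).
  by apply/measurable_EFinP; exact: measurable_gamma_integrand.
have IZ k s : 0 <= k -> (k%:E * eGamma s =
    \int[mu]_(t in `]0%R, +oo[) (k * gamma_integrand s t)%:E)%E.
  move=> k0; under eq_integral do rewrite EFinM.
  rewrite ge0_integralZl_EFin//; last exact: mI.
  by move=> t _; rewrite lee_fin gamma_integrand_ge0.
have p0 : 0 <= l * expR (- ((1 - l) * d)) by rewrite mulr_ge0 ?expR_ge0.
have q0 : 0 <= (1 - l) * expR (l * d) by rewrite mulr_ge0 ?expR_ge0// subr_ge0.
have mM (D : set R) k s : measurable_fun D (fun t => (k * gamma_integrand s t)%:E).
  by apply/measurable_EFinP/measurable_funM => //; exact: measurable_gamma_integrand.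
rewrite !IZ// -ge0_integralD//=; last 4 first.
- by move=> t _; rewrite lee_fin mulr_ge0 ?gamma_integrand_ge0.
- exact: mM.
- by move=> t _; rewrite lee_fin mulr_ge0 ?gamma_integrand_ge0.
- exact: mM.
apply: ge0_le_integral => //=.
- by move=> t _; rewrite lee_fin gamma_integrand_ge0.
- exact: mI.
- by apply: emeasurable_funD; exact: mM.
- move=> t; rewrite in_itv/= andbT => t0.
  by rewrite -EFinD lee_fin gamma_integrand_le_convex.
Qed.

Lemma eGammaSn n : eGamma n.+1%:R = (n`!%:R)%:E.
Proof.
elim: n => [|n IH]; first by rewrite eGamma1.
by rewrite -natr1 eGammaS// IH factS natrM EFinM.
Qed.

(** The functional equation reduces to [s + 1], a convex combination of [1] and [n.+1%:R], where the
    values [1] and [n!] are finite. *)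
Lemma eGamma_fin_num s : 0 < s -> eGamma s \is a fin_num.
Proof.
move=> s0; suff : eGamma (s + 1) \is a fin_num.
  rewrite eGammaS// !ge0_fin_numE ?mule_ge0 ?lee_fin ?eGamma_ge0//; last exact: ltW.
  by apply: contraTT; rewrite -!leNgt !leye_eq => /eqP ->; rewrite gt0_muley.
have [n sn] : exists n, s < n%:R by exists (Num.truncn s).+1; exact: truncnS_gt.
have n0 : 0 < n%:R :> R by exact: lt_trans sn.
have -> : s + 1 = s / n%:R * n.+1%:R + (1 - s / n%:R) * 1.
  by rewrite -natr1; field; rewrite gt_eqF.
rewrite ge0_fin_numE ?eGamma_ge0//.
apply: le_lt_trans (eGamma_le_convex _ _ 0 _) _.
  by rewrite divr_ge0 ?(ltW s0)//= ler_pdivrMr// mul1r ltW.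
by rewrite eGammaSn eGamma1 -!EFinM -EFinD ltry.
Qed.

Lemma Gamma_gt0 s : 0 < s -> 0 < Gamma s.
Proof.
move=> s0; rewrite fine_eGamma fine_gt0// -ge0_fin_numE ?eGamma_ge0//.
rewrite eGamma_fin_num// andbT lt_neqAle eGamma_ge0 andbT eq_sym.
apply/eqP => Gs0.
(* [m.+1%:R] is the midpoint of [s] and [y] and [eGamma m.+1%:R >= 1] *)
have [m sm] : exists m, s < m.+1%:R.
  by exists (Num.truncn s); exact: truncnS_gt.
pose y := 2 * m.+1%:R - s; have y0 : 0 < y.
  by rewrite subr_gt0 (lt_trans sm)// ltr_pMl ?ltr1n.
have Gy0 : 0 <= Gamma y by rewrite fine_eGamma fine_ge0 ?eGamma_ge0.
have l01 : 0 <= (2^-1 : R) <= 1 by lra.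
(* With the term at [s] equal to 0, this [d] makes the bound [Gamma y / (2 * (1 + Gamma y))], which
   is below 1. *)
have := eGamma_le_convex s y (- (2 * ln (1 + Gamma y))) l01.
have -> : 2^-1 * s + (1 - 2^-1) * y = m.+1%:R by rewrite /y; field.
rewrite Gs0 mule0 add0e -(fineK (eGamma_fin_num y0)) -fine_eGamma.
rewrite eGammaSn mulrN mulKf ?pnatr_eq0// expRN lnK ?posrE ?ltr_wpDr//.
rewrite -EFinM lee_fin leNgt => /negP; apply.
apply: (@lt_le_trans _ _ 1); last by rewrite ler1n fact_gt0.
rewrite mulrAC ltr_pdivrMr ?ltr_wpDr//; lra.
Qed.

Lemma GammaS s : 0 < s -> Gamma (s + 1) = s * Gamma s.
Proof. by move=> s0; rewrite !fine_eGamma eGammaS// fineM ?eGamma_fin_num. Qed.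

Lemma ln_Gamma_convex x y l : 0 < x -> 0 < y -> 0 <= l <= 1 ->
  ln (Gamma (l * x + (1 - l) * y)) <= l * ln (Gamma x) + (1 - l) * ln (Gamma y).
Proof.
move=> x0 y0 l01; have /andP[l0 l1] := l01.
have z0 : 0 < l * x + (1 - l) * y by nra.
set w := l * ln (Gamma x) + _.
rewrite -(expRK w) ler_ln ?posrE ?expR_gt0 ?Gamma_gt0//.
(* This [d] balances the two terms: up to their weights [l] and [1 - l], both equal [expR w]. *)
have := eGamma_le_convex x y (ln (Gamma x) - ln (Gamma y)) l01.
rewrite -(fineK (eGamma_fin_num x0)) -(fineK (eGamma_fin_num y0)).
rewrite -(fineK (eGamma_fin_num z0)) -!fine_eGamma -!EFinM -EFinD lee_fin.
move=> /le_trans; apply; rewrite -!mulrA.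
rewrite -{2}(lnK (Gamma_gt0 x0)) -{3}(lnK (Gamma_gt0 y0)) -!expRD.
rewrite /w; move: (ln (Gamma x)) (ln (Gamma y)) => p q.
have -> : - ((1 - l) * (p - q)) + p = l * p + (1 - l) * q by ring.
have -> : l * (p - q) + q = l * p + (1 - l) * q by ring.
by rewrite -mulrDl subrKC mul1r.
Qed.

End GammaFunction.

(** * Series with nonnegative terms *)

Section RealSeries.
Variable R : realType.
Implicit Types (u : R ^nat) (l M : R).

Lemma is_cvg_series_bounded u M :
  (forall n, 0 <= u n) -> (forall n, series u n <= M) -> cvgn (series u).
Proof.
move=> u0 uM; apply: nondecreasing_is_cvgn.
  by move=> m n mn; exact: nondecreasing_series mn.
by exists M => _ [n _ <-].
Qed.

Lemma series_le_limn u n : (forall n, 0 <= u n) -> cvgn (series u) ->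
  series u n <= limn (series u).
Proof.
move=> u0 cu; apply: nondecreasing_cvgn_le => // i j ij.
exact: nondecreasing_series ij.
Qed.

(** If [l] were positive, [u k] would eventually exceed [l / (2 * k)], and the harmonic series would
    converge. *)
Lemma cvg_mulrn_series_eq0 u l : (forall n, 0 <= u n) -> cvgn (series u) ->
  n%:R * u n @[n --> \oo] --> l -> l = 0.
Proof.
move=> u0 cu nul.
have l0 : 0 <= l.
  by apply: (ler_cvg_to (cvg_cst 0) nul); apply: nearW => n; rewrite mulr_ge0.
apply/eqP; rewrite eq_le l0 andbT leNgt; apply/negP => l_gt0.
apply: (@dvg_harmonic R).
have l2 : l / 2 < l by rewrite ltr_pdivrMr// ltr_pMr// ltr1n.
have [N _ Nl] := cvgr_gt _ nul _ l2.
rewrite -(is_cvg_series_restrict N); apply: nondecreasing_is_cvgn.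
  move=> m n mn; apply: nondecreasing_series mn => k _ _ /=.
  by rewrite invr_ge0.
exists (2 / l * limn (series u)) => _ [n _ <-] /=.
apply: (@le_trans _ _ (2 / l * \sum_(N <= k < n) u k.+1)).
  rewrite mulr_sumr; apply: ler_sum_nat => k /andP[Nk _].
  have h : l / 2 < k.+1%:R * u k.+1 := Nl k.+1 (leqW Nk).
  have e : 2 / l * (l / 2) = 1 by field; rewrite gt_eqF.
  rewrite -[leLHS]mul1r ler_pdivrMr// -[leLHS]e.
  rewrite -[leRHS]mulrA; apply: ler_wpM2l; first by rewrite divr_ge0.
  by rewrite [leRHS]mulrC ltW.
rewrite ler_wpM2l ?divr_ge0//.
apply: le_trans (series_le_limn n.+1 u0 cu).
rewrite seriesEnat/= big_nat_recl// ler_wpDl//.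
have [Nn|nN] := leqP N n; last by rewrite big_geq ?(ltnW nN)// sumr_ge0.
by rewrite [leRHS](big_cat_nat (n := N))//= lerDr sumr_ge0.
Qed.

Lemma cvg_invDn (x : R) : 0 < x -> (x + n%:R)^-1 @[n --> \oo] --> (0 : R).
Proof.
move=> x0; apply/(gtr0_cvgV0 (f := fun n => x + n%:R)).
  by apply: nearW => n; rewrite ltr_wpDr.
apply/cvgryPge => M; have /cvgryPge /(_ M) := @cvgr_idn R.
by apply: filterS => n Mn; rewrite ler_wpDl// ltW.
Qed.

End RealSeries.

(** * Convergence at 1, the contiguous relation in [c], and the limit as [c] grows *)

Section HypergeometricCoefficients.
Variables (R : realType) (a b : R).
Hypotheses (a0 : 0 < a) (b0 : 0 < b).
Implicit Types (c : R) (n k : nat).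

Local Notation coef := (hyp2F1_coef a b).

Lemma risingS c n : rising c n.+1 = rising c n * (c + n%:R).
Proof. by rewrite /rising big_ord_recr. Qed.

Lemma rising_gt0 c n : 0 < c -> 0 < rising c n.
Proof. by move=> c0; apply: prodr_gt0 => i _; rewrite ltr_wpDr. Qed.

Lemma risingD1 c n : 0 < c -> rising (c + 1) n = rising c n * ((c + n%:R) / c).
Proof.
move=> c0; elim: n => [|n IH].
  by rewrite /rising !big_ord0 addr0 mul1r divff// gt_eqF.
by rewrite !risingS IH -natr1; field; rewrite gt_eqF.
Qed.

Lemma hyp2F1_coef0 c : coef c 0 = 1.
Proof. by rewrite /hyp2F1_coef /rising !big_ord0 !divr1 mulr1. Qed.

Lemma hyp2F1_coef_gt0 c n : 0 < c -> 0 < coef c n.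
Proof.
by move=> c0; rewrite /hyp2F1_coef !(divr_gt0, mulr_gt0) ?rising_gt0// ltr0n fact_gt0.
Qed.

Lemma hyp2F1_coefS c n : 0 < c -> n.+1%:R * coef c n.+1 =
  (a + n%:R) * (b + n%:R) / (c + n%:R) * coef c n.
Proof.
move=> c0; rewrite /hyp2F1_coef !risingS factS natrM; field.
by rewrite !gt_eqF ?rising_gt0 ?ltr0n ?fact_gt0 ?ltr_wpDr.
Qed.

Lemma hyp2F1_coefD1 c n : 0 < c -> coef (c + 1) n = c / (c + n%:R) * coef c n.
Proof.
move=> c0; rewrite /hyp2F1_coef risingD1//; field.
by rewrite !gt_eqF ?rising_gt0 ?ltr0n ?fact_gt0 ?ltr_wpDr.
Qed.

Lemma hyp2F1_at1 c : hyp2F1 a b c 1 = limn (series (coef c)).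
Proof.
rewrite /hyp2F1 /pseries; congr (limn _); congr series.
by apply/funext => i; rewrite /= expr1n mulr1.
Qed.

(** Gauss's contiguous relation for partial sums: the coefficient recurrences make it telescope,
    leaving one explicit error term. *)
Lemma series_hyp2F1_coef_contiguous c n : 0 < c ->
  c * (c - a - b) * series (coef c) n -
  (c - a) * (c - b) * series (coef (c + 1)) n = - (c * (n%:R * coef c n)).
Proof.
move=> c0; elim: n => [|n IH].
  by rewrite /series/= !big_geq// !(mulr0, mul0r) subr0 oppr0.
rewrite !seriesSr hyp2F1_coefD1// hyp2F1_coefS//.
rewrite (_ : _ - _ = c * (c - a - b) * series (coef c) n -
  (c - a) * (c - b) * series (coef (c + 1)) n +
  (c * (c - a - b) * coef c n -
  (c - a) * (c - b) * (c / (c + n%:R) * coef c n))); last by ring.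
by rewrite IH; field; rewrite gt_eqF// ltr_wpDr.
Qed.

(* Raabe's test with an explicit decreasing majorant of the partial sums *)
Lemma hyp2F1_majorant_decreasing c : a + b < c -> exists N, forall n,
  (N <= n)%N -> let T n := series (coef c) n +
    n%:R * coef c n / ((c - a - b) / 2) in T n.+1 <= T n.
Proof.
move=> abc; have c0 : 0 < c by rewrite (lt_trans _ abc)// addr_gt0.
have d0 : 0 < c - a - b by lra.
pose d := c - a - b; rewrite -/d in d0 *.
(* Beyond this threshold [n%:R * d - 2 * a * b - c * d], the factor deciding the sign of
   [T n - T n.+1], is nonnegative. *)
exists (Num.truncn (2 * a * b / d + c)).+1 => n Nn /=.
have nK : 2 * a * b / d + c <= n%:R.
  by apply: (le_trans (ltW (truncnS_gt _))); rewrite ler_nat.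
have {}nK : 2 * a * b + c * d <= n%:R * d.
  by move: nK; rewrite -(ler_pM2r d0) mulrDl divfK// gt_eqF.
rewrite seriesSr hyp2F1_coefS// -addrA lerD2l -subr_ge0.
have cn0 : 0 < c + n%:R by rewrite ltr_wpDr.
rewrite (_ : _ - _ = coef c n / (d * (c + n%:R)) *
  (n%:R * d - 2 * a * b - c * d)); last first.
  rewrite /d; field; rewrite gt_eqF//=; apply/eqP; move: d0; rewrite /d; lra.
have := ltW (hyp2F1_coef_gt0 n c0); move: (ltW d0) (ltW cn0) => d_ge0 cn_ge0 A_ge0.
by apply: mulr_ge0; [exact: divr_ge0 A_ge0 (mulr_ge0 d_ge0 cn_ge0)|lra].
Qed.

Lemma hyp2F1_majorant_ge c n : a + b < c ->
  series (coef c) n <= series (coef c) n +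
    n%:R * coef c n / ((c - a - b) / 2).
Proof.
move=> abc; have c0 : 0 < c by rewrite (lt_trans _ abc)// addr_gt0.
rewrite lerDl; apply: divr_ge0; last by lra.
by apply: mulr_ge0 => //; exact/ltW/hyp2F1_coef_gt0.
Qed.

(** From rank [N] on, the partial sums lie below a decreasing majorant, hence below its value at
    [N]. *)
Lemma is_cvg_series_hyp2F1_coef c : a + b < c -> cvgn (series (coef c)).
Proof.
move=> abc; have c0 : 0 < c by rewrite (lt_trans _ abc)// addr_gt0.
have coef_ge0 n : 0 <= coef c n by exact/ltW/hyp2F1_coef_gt0.
have [N decT] := hyp2F1_majorant_decreasing abc.
apply: (is_cvg_series_bounded (M := series (coef c) N +
  N%:R * coef c N / ((c - a - b) / 2))) => // n.
have [Nn|/ltnW nN] := leqP N n; last first.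
  by apply: le_trans (hyp2F1_majorant_ge _ abc); exact: nondecreasing_series nN.
apply: (le_trans (hyp2F1_majorant_ge n abc)).
elim: n Nn => [|n IH]; first by rewrite leqn0 => /eqP ->.
rewrite leq_eqVlt => /orP[/eqP <-//|]; rewrite ltnS => Nn.
exact: le_trans (decT n Nn) (IH Nn).
Qed.

(** The majorant [T] is eventually decreasing and bounded below, so it converges. The sequence is a
    multiple of [T] minus the partial sums, so it has a limit, which comparison with the harmonic
    series forces to be 0. *)
Lemma cvg_mulrn_hyp2F1_coef c : a + b < c ->
  n%:R * coef c n @[n --> \oo] --> (0 : R).
Proof.
move=> abc; have c0 : 0 < c by rewrite (lt_trans _ abc)// addr_gt0.
have coef_ge0 n : 0 <= coef c n by exact/ltW/hyp2F1_coef_gt0.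
have cS := is_cvg_series_hyp2F1_coef abc.
have [N decT] := hyp2F1_majorant_decreasing abc.
pose T n := series (coef c) n + n%:R * coef c n / ((c - a - b) / 2).
have cT : cvgn T.
  suff /cvg_ex[l Tl] : cvgn (fun n => T (n + N)%N).
    by apply/cvg_ex; exists l; rewrite -(cvg_shiftn N).
  apply: nonincreasing_is_cvgn.
    apply/nonincreasing_seqP => n; exact: decT (leq_addl _ _).
  exists 0 => _ [n _ <-]; apply: le_trans (hyp2F1_majorant_ge _ abc).
  by apply: sumr_ge0.
suff cu : cvgn (fun n => n%:R * coef c n).
  by rewrite -[X in _ --> X](cvg_mulrn_series_eq0 coef_ge0 cS cu).
have -> : (fun n => n%:R * coef c n) =
    (fun n => (T n - series (coef c) n) * ((c - a - b) / 2)).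
  apply/funext => n; rewrite /T addrAC subrr add0r divfK// mulf_neq0//.
  by rewrite gt_eqF//; lra.
by apply/cvg_ex; eexists; apply: cvgMr_tmp; apply: cvgB; [exact: cT|exact: cS].
Qed.

Lemma hyp2F1_contiguous c : a + b < c ->
  c * (c - a - b) * hyp2F1 a b c 1 = (c - a) * (c - b) * hyp2F1 a b (c + 1) 1.
Proof.
move=> abc; have c0 : 0 < c by rewrite (lt_trans _ abc)// addr_gt0.
have abc1 : a + b < c + 1 by lra.
rewrite !hyp2F1_at1; apply/eqP; rewrite -subr_eq0; apply/eqP.
have cR : c * (c - a - b) * series (coef c) n -
    (c - a) * (c - b) * series (coef (c + 1)) n @[n --> \oo] --> (0 : R).
  rewrite (_ : (fun n => _) = fun n => - (c * (n%:R * coef c n))); last first.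
    by apply/funext => n; exact: series_hyp2F1_coef_contiguous.
  rewrite -oppr0 -(mulr0 c); apply: cvgN; apply: cvgMl_tmp.
  exact: cvg_mulrn_hyp2F1_coef.
apply: cvg_unique cR => //.
by apply: cvgB; apply: cvgMl_tmp; exact: is_cvg_series_hyp2F1_coef.
Qed.

(** The first factor alone supplies the ratio [(c + k%:R) / c]; every later factor only grows when
    [c] does. *)
Lemma rising_ge c k n : 0 < c ->
  (c + k%:R) / c * rising c n.+1 <= rising (c + k%:R) n.+1.
Proof.
move=> c0; elim: n => [|n IH].
  by rewrite !risingS /rising !big_ord0 !addr0 !mul1r divfK// gt_eqF.
rewrite risingS mulrA [leRHS]risingS; apply: ler_pM => //.
- by apply: mulr_ge0; [rewrite divr_ge0 // ltW // ltr_wpDr|exact/ltW/rising_gt0].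
- by rewrite addr_ge0// ltW.
- by rewrite lerD2r lerDl.
Qed.

Lemma hyp2F1_coef_le c k n : 0 < c ->
  coef (c + k%:R) n.+1 <= c / (c + k%:R) * coef c n.+1.
Proof.
move=> c0; have ck0 : 0 < c + k%:R by rewrite ltr_wpDr.
rewrite /hyp2F1_coef mulrA ler_pM2r ?invr_gt0 ?ltr0n ?fact_gt0//.
rewrite [leRHS]mulrCA ler_pM2l ?mulr_gt0 ?rising_gt0// -(invf_div (c + k%:R)) -invfM.
rewrite lef_pV2 ?posrE; [exact: rising_ge|exact: rising_gt0|].
by apply: mulr_gt0; [exact: divr_gt0|exact: rising_gt0].
Qed.

(** The constant term is 1, and all the others shrink at least by the common factor
    [c / (c + k%:R)], so no interchange of limits is involved. *)
Lemma cvg_hyp2F1_addn c : a + b < c ->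
  hyp2F1 a b (c + k%:R) 1 @[k --> \oo] --> (1 : R).
Proof.
move=> abc; have c0 : 0 < c by rewrite (lt_trans _ abc)// addr_gt0.
have cS := is_cvg_series_hyp2F1_coef abc.
have ck k : 0 < c + k%:R by rewrite ltr_wpDr.
have abck k : a + b < c + k%:R by rewrite ltr_wpDr.
apply: (@squeeze_cvgr _ _ _ _ (cst 1)
  (fun k => 1 + c / (c + k%:R) * hyp2F1 a b c 1)); first last.
- rewrite -[X in _ --> X]addr0 -(mul0r (hyp2F1 a b c 1)) -(mulr0 c).
  apply: cvgD; first exact: cvg_cst.
  by apply: cvgMr_tmp; apply: cvgMl_tmp; exact: cvg_invDn.
- exact: cvg_cst.
apply: nearW => k; rewrite !hyp2F1_at1; apply/andP; split.
  have := series_le_limn 1 (fun n => ltW (hyp2F1_coef_gt0 n (ck k)))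
    (is_cvg_series_hyp2F1_coef (abck k)).
  by rewrite seriesEnat/= big_nat1 hyp2F1_coef0.
apply: limr_le; first exact: is_cvg_series_hyp2F1_coef.
(* The empty partial sum is treated apart, having no constant term to split off. *)
apply: nearW => -[|n].
  rewrite /series/= big_geq// addr_ge0// mulr_ge0 ?divr_ge0 ?(ltW c0) ?(ltW (ck k))//.
  apply: limr_ge => //; apply: nearW => m; apply: sumr_ge0 => i _.
  exact/ltW/hyp2F1_coef_gt0.
rewrite seriesEnat/= big_nat_recl// hyp2F1_coef0 lerD2l.
apply: (@le_trans _ _ (c / (c + k%:R) * \sum_(0 <= i < n) coef c i.+1)).
  by rewrite mulr_sumr; apply: ler_sum => i _; exact: hyp2F1_coef_le.
rewrite ler_wpM2l ?divr_ge0 ?(ltW c0) ?(ltW (ck k))//.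
apply: le_trans (series_le_limn n.+1 _ cS); last first.
  by move=> i; exact/ltW/hyp2F1_coef_gt0.
by rewrite seriesEnat/= big_nat_recl// hyp2F1_coef0 lerDr.
Qed.

End HypergeometricCoefficients.

(** * Mixed differences of a convex [phi], with [ln] of [Gamma] as the model *)

Section BohrMollerup.
Variables (R : realType) (phi : R -> R).
Hypothesis phi_convex : forall x y l, 0 < x -> 0 < y -> 0 <= l <= 1 ->
  phi (l * x + (1 - l) * y) <= l * phi x + (1 - l) * phi y.
Implicit Types a b c : R.

(** Both [c - a] and [c - b] are convex combinations of [c] and [c - a - b], with complementary
    weights; the two convexity inequalities add up. *)
Lemma convex_mixed_difference_ge0 a b c : 0 < a -> 0 < b -> a + b < c ->
  phi (c - a) + phi (c - b) <= phi c + phi (c - a - b).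
Proof.
move=> a0 b0 abc; have ab0 : 0 < a + b by rewrite addr_gt0.
have frac01 (x y : R) : 0 < x -> 0 < y -> 0 <= x / (x + y) <= 1.
  move=> x0 y0; have xy0 : 0 < x + y by rewrite addr_gt0.
  apply/andP; split; first by rewrite divr_ge0// ltW.
  by rewrite ler_pdivrMr// mul1r lerDl ltW.
have l01 : 0 <= b / (a + b) <= 1 by rewrite (addrC a) frac01.
have l01' : 0 <= a / (a + b) <= 1 by rewrite frac01.
have c0 : 0 < c by lra.
have cab0 : 0 < c - a - b by lra.
have := phi_convex c0 cab0 l01.
have := phi_convex c0 cab0 l01'.
have -> : 1 - b / (a + b) = a / (a + b) by field; rewrite gt_eqF.
have -> : 1 - a / (a + b) = b / (a + b) by field; rewrite gt_eqF.
have -> : a / (a + b) * c + b / (a + b) * (c - a - b) = c - b.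
  by field; rewrite gt_eqF.
have -> : b / (a + b) * c + a / (a + b) * (c - a - b) = c - a.
  by field; rewrite gt_eqF.
have phiE x : a / (a + b) * phi x + b / (a + b) * phi x = phi x.
  by field; rewrite gt_eqF.
have := phiE c; have := phiE (c - a - b).
lra.
Qed.

Hypothesis phiS : forall s, 0 < s -> phi (s + 1) = phi s + ln s.

(** Two increments of [phi] over length [a] are compared with slopes over unit intervals, which
    [phiS] evaluates as logarithms: the one ending at [c] with the slope on [[c, c + 1]], the one
    starting at [c - a - b] with the slope just to its left. *)
Lemma convex_mixed_difference_le a b c : 0 < a -> 0 < b -> a + b + 1 < c ->
  phi c + phi (c - a - b) - (phi (c - a) + phi (c - b)) <=
  a * (a + b + 1) / (c - (a + b + 1)).
Proof.
move=> a0 b0 abc; have s0 : 0 < c - (a + b + 1) by lra.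
have c0 : 0 < c by lra.
have ca0 : 0 < c - a by lra.
have cb0 : 0 < c - b by lra.
have a1 : 0 < 1 + a by lra.
have l01 : 0 <= (1 + a)^-1 <= 1.
  by rewrite invr_ge0 (ltW a1)/= invf_le1// lerDl ltW.
have l01' : 0 <= a / (1 + a) <= 1.
  apply/andP; split; first by rewrite divr_ge0// ltW.
  by rewrite ler_pdivrMr// mul1r lerDr.
have up : phi c - phi (c - a) <= a * ln c.
  have := phi_convex ca0 (addr_gt0 c0 ltr01) l01; rewrite phiS//.
  have -> : (1 + a)^-1 * (c - a) + (1 - (1 + a)^-1) * (c + 1) = c.
    by field; rewrite gt_eqF.
  rewrite -(ler_pM2l a1).
  have -> : (1 + a) * ((1 + a)^-1 * phi (c - a) +
      (1 - (1 + a)^-1) * (phi c + ln c)) = phi (c - a) + a * (phi c + ln c).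
    by field; rewrite gt_eqF.
  by lra.
have low : a * ln (c - (a + b + 1)) <= phi (c - b) - phi (c - a - b).
  have := phi_convex s0 cb0 l01'.
  have -> : a / (1 + a) * (c - (a + b + 1)) + (1 - a / (1 + a)) * (c - b) =
      c - a - b by field; rewrite gt_eqF.
  rewrite -(ler_pM2l a1).
  have -> : (1 + a) * (a / (1 + a) * phi (c - (a + b + 1)) +
      (1 - a / (1 + a)) * phi (c - b)) =
      a * phi (c - (a + b + 1)) + phi (c - b) by field; rewrite gt_eqF.
  have -> : c - a - b = c - (a + b + 1) + 1 by ring.
  rewrite phiS//; lra.
have lnD : ln c - ln (c - (a + b + 1)) <= (a + b + 1) / (c - (a + b + 1)).
  rewrite -ln_div ?posrE//.
  have -> : c / (c - (a + b + 1)) = 1 + (a + b + 1) / (c - (a + b + 1)).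
    by field; rewrite gt_eqF.
  apply: le_ln1Dx; apply: (@lt_le_trans _ _ 0); first by lra.
  by apply: divr_ge0; lra.
rewrite -(ler_pM2l a0) mulrA in lnD.
lra.
Qed.

End BohrMollerup.

(** * Gauss's summation theorem *)

Section GaussSummation.
Variables (R : realType) (a b : R).
Implicit Types (c : R) (k : nat).

Definition gauss_quotient c : R :=
  Gamma c * Gamma (c - a - b) / (Gamma (c - a) * Gamma (c - b)).

Lemma gauss_quotient_gt0 c : 0 < a -> 0 < b -> a + b < c -> 0 < gauss_quotient c.
Proof.
move=> a0 b0 abc; apply: divr_gt0; apply: mulr_gt0; apply: Gamma_gt0; lra.
Qed.

Lemma gauss_quotient_contiguous c : 0 < a -> 0 < b -> a + b < c ->
  c * (c - a - b) * gauss_quotient c =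
  (c - a) * (c - b) * gauss_quotient (c + 1).
Proof.
move=> a0 b0 abc; rewrite /gauss_quotient.
have -> : c + 1 - a - b = c - a - b + 1 by ring.
have -> : c + 1 - a = c - a + 1 by ring.
have -> : c + 1 - b = c - b + 1 by ring.
have [c1 c2 c3 c4] : [/\ 0 < c, 0 < c - a - b, 0 < c - a & 0 < c - b].
  by split; lra.
rewrite !GammaS//; have := (Gamma_gt0 c3, Gamma_gt0 c4).
(* generalized so that no tactic unfolds the integrals *)
move: (Gamma c) (Gamma (c - a - b)) (Gamma (c - a)) (Gamma (c - b)).
by move=> p q r s [r0 s0]; field; rewrite !gt_eqF.
Qed.

Lemma ln_gauss_quotient c : 0 < a -> 0 < b -> a + b < c -> ln (gauss_quotient c) =
  ln (Gamma c) + ln (Gamma (c - a - b)) -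
  (ln (Gamma (c - a)) + ln (Gamma (c - b))).
Proof.
move=> a0 b0 abc.
have [c1 c2 c3 c4] : [/\ 0 < Gamma c, 0 < Gamma (c - a - b),
    0 < Gamma (c - a) & 0 < Gamma (c - b)].
  by split; apply: Gamma_gt0; lra.
rewrite /gauss_quotient; move: c1 c2 c3 c4.
move: (Gamma c) (Gamma (c - a - b)) (Gamma (c - a)) (Gamma (c - b)).
by move=> p q r s p0 q0 r0 s0; rewrite ln_div ?lnM ?posrE ?mulr_gt0.
Qed.

Lemma ln_gauss_quotient_ge0 c : 0 < a -> 0 < b -> a + b < c ->
  0 <= ln (gauss_quotient c).
Proof.
move=> a0 b0 abc; rewrite ln_gauss_quotient// subr_ge0.
exact: (convex_mixed_difference_ge0 (@ln_Gamma_convex R)).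
Qed.

Lemma ln_gauss_quotient_le c : 0 < a -> 0 < b -> a + b + 1 < c ->
  ln (gauss_quotient c) <= a * (a + b + 1) / (c - (a + b + 1)).
Proof.
move=> a0 b0 abc; rewrite ln_gauss_quotient//; last first.
  by rewrite (lt_trans _ abc)// ltrDl.
apply: (convex_mixed_difference_le (@ln_Gamma_convex R)) => // s s0.
by rewrite GammaS// lnM ?posrE ?Gamma_gt0// addrC.
Qed.

Lemma cvg_gauss_quotient_addn c : 0 < a -> 0 < b -> a + b < c ->
  gauss_quotient (c + k%:R) @[k --> \oo] --> (1 : R).
Proof.
move=> a0 b0 abc; pose d := c - a - b; have d0 : 0 < d by rewrite /d; lra.
(* The shift brings the argument above [a + b + 1], as [ln_gauss_quotient_le] demands. *)
rewrite -(cvg_shiftn 1).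
have -> : [sequence gauss_quotient (c + (k + 1)%N%:R)]_k =
    (fun k => expR (ln (gauss_quotient (c + (k + 1)%N%:R)))).
  apply/funext => k; rewrite lnK// posrE; apply: gauss_quotient_gt0 => //.
  by rewrite ltr_wpDr.
suff : expR (ln (gauss_quotient (c + (k + 1)%N%:R))) @[k --> \oo] --> expR 0.
  by rewrite expR0.
apply: continuous_cvg; first exact: continuous_expR.
apply: (@squeeze_cvgr _ _ _ _ (cst 0)
  (fun k => a * (a + b + 1) * (d + k%:R)^-1)); first last.
- by rewrite -(mulr0 (a * (a + b + 1))); apply: cvgMl_tmp; exact: cvg_invDn.
- exact: cvg_cst.
apply: nearW => k; rewrite ln_gauss_quotient_ge0 ?ltr_wpDr//=.
have -> : d + k%:R = c + (k + 1)%:R - (a + b + 1) by rewrite natrD /d; ring.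
by apply: ln_gauss_quotient_le => //; rewrite natrD; have := ler0n R k; lra.
Qed.

Lemma gauss_summation c : 0 < a -> 0 < b -> a + b < c ->
  hyp2F1 a b c 1 = gauss_quotient c.
Proof.
move=> a0 b0 abc; pose r := hyp2F1 a b c 1 / gauss_quotient c.
have g0 k : 0 < gauss_quotient (c + k%:R).
  by apply: gauss_quotient_gt0 => //; rewrite ltr_wpDr.
(* Both sides obey the same contiguous relation, so their ratio at [c] persists along [c + k]. *)
have rE k : hyp2F1 a b (c + k%:R) 1 = r * gauss_quotient (c + k%:R).
  elim: k => [|k IH]; first by rewrite addr0 /r divfK// gt_eqF ?gauss_quotient_gt0.
  have abck : a + b < c + k%:R by rewrite ltr_wpDr.
  have q0 : (c + k%:R - a) * (c + k%:R - b) != 0.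
    by rewrite mulf_neq0 ?gt_eqF//; lra.
  rewrite -natr1 addrA; apply: (mulfI q0).
  rewrite -hyp2F1_contiguous// mulrCA -gauss_quotient_contiguous// IH; ring.
suff r1 : r = 1 by have := rE 0%N; rewrite addr0 r1 mul1r.
have cvgF : r * gauss_quotient (c + k%:R) @[k --> \oo] --> (1 : R).
  rewrite (_ : (fun k => _) = fun k => hyp2F1 a b (c + k%:R) 1).
    exact: cvg_hyp2F1_addn.
  by apply/funext => k; rewrite rE.
rewrite -[LHS]mulr1; apply: cvg_unique cvgF => //.
by apply: cvgMl_tmp; exact: cvg_gauss_quotient_addn.
Qed.

End GaussSummation.

(** * Monotonicity of [F] and its approach to [F 1] *)

Section HypergeometricOnUnitInterval.
Variables (R : realType) (a b c : R).
Hypotheses (a_gt0 : 0 < a) (b_gt0 : 0 < b) (c_gtD : a + b < c).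
Implicit Types (x y : R).

Local Notation coef := (hyp2F1_coef a b c).
Local Notation F := (hyp2F1 a b c).

Let coef_ge0 n : 0 <= coef n.
Proof.
apply/ltW/hyp2F1_coef_gt0 => //.
exact: lt_trans (addr_gt0 a_gt0 b_gt0) c_gtD.
Qed.

Lemma is_cvg_hyp2F1 x : 0 <= x <= 1 -> cvgn (pseries coef x).
Proof.
move=> /andP[x0 x1].
apply: series_le_cvg (is_cvg_series_hyp2F1_coef a_gt0 b_gt0 c_gtD) => n //.
  by rewrite mulr_ge0 ?exprn_ge0.
by rewrite ler_piMr ?exprn_ile1.
Qed.

Lemma hyp2F1_ge_series x n : 0 <= x <= 1 -> pseries coef x n <= F x.
Proof.
move=> x01; apply: series_le_limn; last exact: is_cvg_hyp2F1.
by move=> i; rewrite mulr_ge0 ?exprn_ge0//; case/andP: x01.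
Qed.

Lemma hyp2F1_ge0 x : 0 <= x <= 1 -> 0 <= F x.
Proof.
by move=> /(hyp2F1_ge_series 0); rewrite /pseries/series/= big_geq.
Qed.

Lemma ler_hyp2F1 x y : 0 <= x -> x <= y -> y <= 1 -> F x <= F y.
Proof.
move=> x0 xy y1; apply: lim_series_le.
- by apply: is_cvg_hyp2F1; rewrite x0 (le_trans xy).
- by apply: is_cvg_hyp2F1; rewrite y1 (le_trans x0).
- by move=> n; rewrite ler_wpM2l ?lerXn2r ?nnegrE// (le_trans x0).
Qed.

(** Some partial sum at 1 already exceeds [M]. As a polynomial it still does slightly to the left of
    1, where it bounds [F] from below; Abel's theorem is thus avoided. *)
Lemma hyp2F1_gt_near1 M : M < F 1 -> exists2 x, 0 < x < 1 & M < F x.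
Proof.
move=> MF; have one01 : 0 <= (1 : R) <= 1 by rewrite ler01 lexx.
have [N _ /(_ N (leqnn N))/= MN] := cvgr_gt _ (is_cvg_hyp2F1 one01) _ MF.
have cS : {for 1, continuous (fun x => pseries coef x N)}.
  rewrite /pseries/series/=; apply: cvg_big => [|i _].
    exact: add_continuous.
  by apply: cvgMl_tmp; exact: exprn_continuous.
have /cvg_at_left_filter/cvgr_gt/(_ _ MN) h := cS.
near (1 : R)^'- => x.
have x01 : 0 < x < 1.
  by apply/andP; split; near: x; [exact: nbhs_left_gt|exact: nbhs_left_lt].
exists x => //; apply: lt_le_trans (hyp2F1_ge_series N _); last by lra.
by near: x.
Unshelve. all: by end_near.
Qed.

End HypergeometricOnUnitInterval.

Theorem theorem1p4 (R : realType) (a b c : R)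
    (a_gt0 : 0 < a) (b_gt0 : 0 < b) (c_gtD : a + b < c) :
  let A : R := Gamma c * Gamma (c - a - b) / (Gamma (c - a) * Gamma (c - b)) in
  [/\ forall x y : R, 0 < x < 1 -> 0 < y < 1 -> `|D_F a b c x y| <= A,
      A = hyp2F1 a b c 1
    & forall B : R, B < A ->
        ~ (forall x y : R, 0 < x < 1 -> 0 < y < 1 -> `|D_F a b c x y| <= B)].
Proof.
move=> A; have AE : A = hyp2F1 a b c 1 by rewrite gauss_summation.
have mono := ler_hyp2F1 a_gt0 b_gt0 c_gtD.
have ge0 := hyp2F1_ge0 a_gt0 b_gt0 c_gtD.
split => // [x y /andP[x0 x1] /andP[y0 y1]|B].
  (* Writing [z] for [x + y - x * y = 1 - (1 - x) * (1 - y)]: the upper bound follows from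
     [F x <= F z] and [F y <= F 1], the lower one from [F x, F y >= 0] and [F z <= F 1]. *)
  have xz : x <= x + y - x * y by nra.
  have yz : y <= x + y - x * y by nra.
  have z1 : x + y - x * y <= 1 by nra.
  rewrite AE /D_F ler_norml.
  have := mono _ _ (ltW x0) xz z1.
  have := mono _ _ (le_trans (ltW x0) xz) z1 (lexx _).
  have := mono _ _ (ltW y0) (ltW y1) (lexx _).
  have /ge0 : 0 <= x <= 1 by rewrite !ltW.
  have /ge0 : 0 <= y <= 1 by rewrite !ltW.
  lra.
rewrite AE => BF DB.
(* Above this midpoint, [2 * F x > F 1 + B]; since the subtracted value is at most [F 1], [D_F] at
   [(x, x)] exceeds [B]. *)
have [|x x01 Fx] := @hyp2F1_gt_near1 _ _ _ _ a_gt0 b_gt0 c_gtD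
  ((hyp2F1 a b c 1 + B) / 2); first by lra.
have := le_trans (ler_norm _) (DB x x x01 x01); rewrite /D_F.
have /andP[x0 x1] := x01.
have z0 : 0 <= x + x - x * x by nra.
have z1 : x + x - x * x <= 1 by nra.
have := mono _ _ z0 z1 (lexx _).
lra.
Qed.
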